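(* Let $\mathcal{H}$ be a real Hilbert space, $K\subset\mathcal{H}$ a nonempty closed convex set, and $F:\mathcal{H}\to\mathcal{H}$ an operator such that: (C1) $\Omega_D\neq\emptyset$; (C2) $F$ is quasimonotone and $L$-Lipschitz continuous on $\mathcal{H}$ (with $L>0$); (C3) whenever a sequence $\{x_k\}\subset\mathcal{H}$ converges weakly to $x$, one has $\|F(x)\|\le\liminf_{k\to\infty}\|F(x_k)\|$; (C4) with $A:=\{u\in K:F(u)=0\}\setminus\Omega_D$, for every $p\in\Omega_D$ there exists $\delta_p>0$ such that $\|y_1-y_2\|\ge 2\delta_p$ for any two distinct points $y_1,y_2\in A_p:=\{p\}\cup A$. Let $\lambda\in(0,\frac1L)$. Then the trajectories $x(t)$ and $y(t)$ generated by $$\begin{cases} y(t)=P_K(x(t)-\lambda F(x(t))),\\ \dot x(t)+x(t)=y(t)+\lambda\,[F(x(t))-F(y(t))],\\ x(0)=x_0\in\mathcal{H}\end{cases}$$ converge weakly, as $t\to\infty$, to a point of $\Omega$.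
   Context: $P_K$ is the metric projection onto $K$. $\Omega:=\{x^*\in K:\langle F(x^* ),y-x^*\rangle\ge 0\ \ \forall y\in K\}$ is the solution set of the variational inequality $VI(F,K)$, and $\Omega_D:=\{x^*\in K:\langle F(y),y-x^*\rangle\ge 0\ \ \forall y\in K\}$. $F$ is quasimonotone on a set $S$ if for all $\xi,\eta\in S$, $\langle F(\xi),\eta-\xi\rangle>0$ implies $\langle F(\eta),\eta-\xi\rangle\ge 0$; in (C2) this is meant with $S=\mathcal{H}$. $F$ is $L$-Lipschitz if $\|F(\xi)-F(\eta)\|\le L\|\xi-\eta\|$ for all $\xi,\eta\in\mathcal{H}$. The trajectory $x:[0,\infty)\to\mathcal{H}$ exists and is unique by the global Cauchy–Lipschitz theorem. *)

(* Defs.v *)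
From HB Require Import structures.
From mathcomp Require Import all_boot all_order all_algebra.
From mathcomp Require Import all_classical all_reals all_analysis.

Set Implicit Arguments.
Unset Strict Implicit.
Unset Printing Implicit Defensive.

Import Order.TTheory GRing.Theory Num.Theory.
Import numFieldNormedType.Exports.

Local Open Scope classical_set_scope.
Local Open Scope ring_scope.

(* Real Hilbert spaces: complete normed spaces whose norm comes from a
   symmetric positive definite bilinear form. *)
HB.mixin Record CompleteNormedModule_isHilbert (R : realType) H
    of CompleteNormedModule R H := {
  inner : {dot H for (@idfun R)};
  sqr_normE : forall u : H, `|u| ^+ 2 = inner u u
}.

#[short(type="hilbertType")]
HB.structure Definition Hilbert (R : realType) :=
  {H of CompleteNormedModule_isHilbert R H & CompleteNormedModule R H}.

Notation "''[' u , v ]" := (inner u v) : ring_scope.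

Section VariationalInequality.
Context {R : realType} {H : hilbertType R}.
Implicit Types (K S : set H) (F : H -> H).

Definition weak_cvg_to (G : set_system H) (p : H) : Prop :=
  forall z : H, '[u, z] @[u --> G] --> '[p, z].

Definition nearest_points K (u : H) : set H :=
  [set z | K z /\ forall w, K w -> `|u - z| <= `|u - w|].

(* The default value 0 is only taken when u has no nearest point in K, which
   does not happen when K is nonempty, closed and convex. *)
Definition metric_proj K (u : H) : H := xget 0 (nearest_points K u).

Definition VI_sol F K : set H :=
  [set p | K p /\ forall y, K y -> 0 <= '[F p, y - p]].

Definition dual_VI_sol F K : set H :=
  [set p | K p /\ forall y, K y -> 0 <= '[F y, y - p]].

Definition quasimonotone_on S F : Prop :=
  forall xi eta, S xi -> S eta ->
    0 < '[F xi, eta - xi] -> 0 <= '[F eta, eta - xi].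

Definition norm_weakly_lsc F : Prop :=
  forall (u : nat -> H) (p : H), weak_cvg_to (u k @[k --> \oo]) p ->
    (`|F p|%:E <= limn_einf (fun k => `|F (u k)|%:E))%E.

Definition zeros_outside_dual F K : set H :=
  [set u | K u /\ F u = 0] `\` dual_VI_sol F K.

Definition zeros_separated F K : Prop :=
  forall p, dual_VI_sol F K p ->
    exists2 delta : R, 0 < delta &
      forall y1 y2, ([set p] `|` zeros_outside_dual F K) y1 ->
        ([set p] `|` zeros_outside_dual F K) y2 ->
        y1 != y2 -> 2 * delta <= `|y1 - y2|.

(* The value f 0 together with f' = g on [0, +oo[, the derivative at 0 being
   the right one; f is irrelevant on negative times. *)
Definition cauchy_solution (f g : R -> H) (f0 : H) : Prop :=
  [/\ f 0 = f0,
      h^-1 *: (f h - f 0) @[h --> 0^'+] --> g 0 &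
      forall t : R, 0 < t -> is_derive t 1 f (g t)].

Definition FBF_trajectory F K (lambda : R) (x0 : H) (x y : R -> H) : Prop :=
  (forall t, 0 <= t -> y t = metric_proj K (x t - lambda *: F (x t))) /\
  cauchy_solution x (fun t => y t + lambda *: (F (x t) - F (y t)) - x t) x0.

End VariationalInequality.

(* Main.v *)
Require Import Defs.
From mathcomp Require Import all_boot all_order all_algebra.
From mathcomp Require Import all_classical all_reals all_analysis.
From mathcomp Require Import lra ring.
Import Order.TTheory GRing.Theory Num.Theory.
Import numFieldNormedType.Exports.
Local Open Scope classical_set_scope.
Local Open Scope ring_scope.

(** Write r(u) = u - y(u), where y(u) = P_K (u - lambda F u), so that the
trajectory solves x' = f(x) with f(u) = - (r(u) - lambda (F u - F (y(u)))).

Descent. For p in Omega_D, the obtuse angle property of P_K at y(u) and the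
inequality 0 <= <F (y(u)), y(u) - p> give
<f(u), u - p> <= - (1 - lambda L) |r(u)|^2 ([fbf_field_descent]). Hence
|x(t) - p| decreases and converges, x is bounded and Lipschitz, and r(x(t))
tends to 0: whenever |r(x(t))| > e, it stays above e / 2 for a fixed length of
time, which costs |x(t) - p|^2 a fixed amount
([trajectory_residual_cvg0]).

Weak limit points. Let z be a weak limit point of x. It lies in K because
x - r(x) does and K is weakly closed. If F z is not 0, the lower semicontinuity
of |F| keeps F (x(t_k)) away from 0, so the points w of K can be shifted
slightly in the direction F (x(t_k)) to make the hypothesis of quasimonotonicity
strict; in the limit z is in Omega_D ([approximate_weak_limit_dual]). So z is in
Omega_D or is a zero of F in K; in both cases it solves the variational
inequality (by Minty's argument in the first one, [dual_VI_sol_sub]).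

Uniqueness. By Opial's argument at most one weak limit point p is in Omega_D
([opial_unique]), so all of them lie in the set {p} u A, whose points are at
distance at least d = 2 delta_p from each other. This separation is for the
norm, not for the weak topology, and {p} u A may be infinite; the link is made
by slices. If a weak limit point z0 almost attains the supremum of |z| over the
weak limit points, then every weak limit point w with
<w, z0> > |z0|^2 - d^2 / 4 satisfies |w - z0| < d, that is, w = z0. If there
were another weak limit point, the continuous function <x(t), z0> would take the
value |z0|^2 - d^2 / 8 at arbitrarily large times, and weak compactness would
give a weak limit point w with <w, z0> equal to that value, which lies in the
slice but differs from z0. So z0 is the only weak limit point and x converges
weakly to it ([separated_weak_omega_limit_cvg]); y = x - r(x) does too.

The Hilbert space tools behind this (projection on a closed convex set, Riesz
representation, weak sequential compactness of bounded sets) come from one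
minimization principle, [strongly_midconvex_min], and from ultrafilters. *)

(** * Inner products *)

Section inner_product.
Context {R : realType} {H : hilbertType R}.
Implicit Types u v w : H.

Lemma innerC u v : '[u, v] = '[v, u].
Proof. by rewrite hermC expr0 mul1r. Qed.

Lemma innerDl u v w : '[u + v, w] = '[u, w] + '[v, w].
Proof. by rewrite linearDl. Qed.

Lemma innerDr u v w : '[w, u + v] = '[w, u] + '[w, v].
Proof. by rewrite linearDr. Qed.

Lemma innerNl u w : '[- u, w] = - '[u, w].
Proof. by rewrite linearNl. Qed.

Lemma innerNr u w : '[w, - u] = - '[w, u].
Proof. by rewrite linearNr. Qed.

Lemma innerZl a u w : '[a *: u, w] = a * '[u, w].
Proof. by rewrite linearZl_LR. Qed.

Lemma innerZr a u w : '[w, a *: u] = a * '[w, u].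
Proof. by rewrite linearZr_LR. Qed.

Definition innerE := (innerDl, innerDr, innerNl, innerNr, innerZl, innerZr).

Lemma inner_ge0 u : 0 <= '[u, u].
Proof. by rewrite -sqr_normE sqr_ge0. Qed.

Lemma inner_eq0 u : '[u, u] <= 0 -> u = 0.
Proof.
rewrite -sqr_normE => u0; apply/normr0_eq0/eqP.
by rewrite -sqrf_eq0 eq_le u0 sqr_ge0.
Qed.

(** Cauchy-Schwarz: expand the square norm of |v| u - |u| v. *)
Lemma inner_le_norm u v : '[u, v] <= `|u| * `|v|.
Proof.
have [->|v0] := eqVneq v 0; first by rewrite linear0r normr0 mulr0.
have [->|u0] := eqVneq u 0; first by rewrite linear0l normr0 mul0r.
have uv : 0 < `|u| * `|v| by rewrite mulr_gt0 ?normr_gt0.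
have := inner_ge0 (`|v| *: u - `|u| *: v).
rewrite !innerE (innerC v u) -!sqr_normE => h.
rewrite -(ler_pM2l uv); nra.
Qed.

Lemma norm_inner_le u v : `|'[u, v]| <= `|u| * `|v|.
Proof.
rewrite ler_norml inner_le_norm andbT lerNl -innerNl.
by rewrite (le_trans (inner_le_norm _ _))// normrN.
Qed.

Lemma inner_sub_sqr u v : `|u - v| ^+ 2 = `|u| ^+ 2 - 2 * '[u, v] + `|v| ^+ 2.
Proof. by rewrite !sqr_normE !innerE (innerC v u); ring. Qed.

Lemma cvg_inner T (G : set_system T) {FG : Filter G} (f g : T -> H) u v :
  f t @[t --> G] --> u -> g t @[t --> G] --> v ->
  '[f t, g t] @[t --> G] --> '[u, v].
Proof.
move=> fu gv.
(* Polarization reduces joint continuity to the continuity of the norm. *)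
have polar (a b : H) : '[a, b] = (`|a + b| ^+ 2 - `|a - b| ^+ 2) / 4.
  by rewrite !sqr_normE !innerE (innerC b a); field.
rewrite polar; under eq_fun do rewrite polar.
apply: cvgMl; apply: cvgB; rewrite !expr2; under eq_fun do rewrite expr2;
  apply: cvgM; apply: cvg_norm; by [exact: cvgD | exact: cvgB].
Qed.

End inner_product.

(** Dividing a first-order condition by the step s and letting s tend to 0:
the form in which limits along segments are taken below. *)
Lemma le0_of_small {R : realType} (a b : R) :
  (forall s, 0 < s -> s <= 1 -> a <= s * b) -> a <= 0.
Proof.
move=> h; rewrite leNgt; apply/negP => a0.
have := h 1 ltr01 (lexx _); rewrite mul1r => ab.
have b0 : 0 < b by exact: lt_le_trans ab.
have := h (a / (2 * b)).
have -> : a / (2 * b) * b = a / 2 by field; exact: lt0r_neq0.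
rewrite divr_gt0 ?mulr_gt0// ler_pdivrMr ?mulr_gt0//.
by move=> /(_ isT); lra.
Qed.

(** * Minimization of strongly midconvex functions *)

Section minimizer.
Context {R : realType} {H : hilbertType R}.
Implicit Types u v w : H.

(** The defect of midconvexity makes every minimizing sequence Cauchy. The same
statement serves for the projection, with g the square of the distance to a
point, and for the Riesz representation, with g w = |w|^2 - 2 l(w). *)
Lemma strongly_midconvex_min (K : set H) (g : H -> R) (m : R) :
  K !=set0 -> closed K -> continuous g ->
  (forall a b, K a -> K b -> K (2^-1 *: (a + b))) ->
  (forall a, K a -> m <= g a) ->
  (forall a b, K a -> K b ->
     g (2^-1 *: (a + b)) <= (g a + g b) / 2 - `|a - b| ^+ 2 / 4) ->
  exists2 z, K z & forall w, K w -> g z <= g w.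
Proof.
move=> [k0 Kk0] Kc gc Kmid mg gmid.
pose i := inf (g @` K).
have hi : has_inf (g @` K).
  split; first by exists (g k0), k0.
  by exists m => _ [a Ka <-]; exact: mg.
have ige a : K a -> i <= g a.
  by move=> Ka; apply: ge_inf; [exact: hi.2 | exists a].
have ex n : exists a, K a /\ g a < i + n.+1%:R^-1.
  have [|_ [a Ka <-] ai] := inf_adherent (eps := n.+1%:R^-1) _ hi.
    by rewrite invr_gt0.
  by exists a.
pose z n := projT1 (cid (ex n)).
have Kz n : K (z n) by rewrite /z; case: cid => a [].
have gz n : g (z n) < i + n.+1%:R^-1 by rewrite /z; case: cid => a [].
have cau : cauchy (z @ \oo).
  apply: cauchy_exP => e e0.
  have [N _ hN] : \forall N \near \oo, N.+1%:R^-1 < e ^+ 2 / 4 :> R.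
    by apply: near_infty_natSinv_lt (PosNum _); rewrite divr_gt0 ?exprn_gt0.
  have {}hN := hN N (leqnn _).
  exists (z N); exists N => // n /= Nn.
  rewrite -ball_normE /ball_/=.
  rewrite -(@ltr_pXn2r _ 2)// ?nnegrE ?(ltW e0)//.
  have h1 := gmid _ _ (Kz N) (Kz n).
  have h2 := ige _ (Kmid _ _ (Kz N) (Kz n)).
  have h3 := gz N; have h4 := gz n.
  have h5 : n.+1%:R^-1 <= N.+1%:R^-1 :> R.
    by rewrite lef_pV2 ?posrE// ler_nat ltnS.
  move: h1 h2 h3 h4 h5 hN; set d := `|z N - z n| ^+ 2.
  move: (N.+1%:R^-1) (n.+1%:R^-1) => p q; lra.
have /cauchy_cvgP /cvg_ex [l zl] := cau.
exists l.
  by apply: (closed_cvg K _ _ _ zl) => //; exact: nearW.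
move=> w Kw; apply: le_trans (ige _ Kw).
have gl : g (z n) @[n --> \oo] --> g l by apply: continuous_cvg; [exact: gc|].
have il : i + n.+1%:R^-1 @[n --> \oo] --> i.
  rewrite -[X in _ --> X]addr0; apply: cvgD; first exact: cvg_cst.
  exact: cvg_harmonic.
by apply: ler_cvg_to gl il _; apply: nearW => n; exact: ltW.
Qed.

(** The parallelogram law, in the form that the minimization principle asks
for. *)
Lemma norm_midpoint (a b : H) :
  `|2^-1 *: (a + b)| ^+ 2 = (`|a| ^+ 2 + `|b| ^+ 2) / 2 - `|a - b| ^+ 2 / 4.
Proof. by rewrite !sqr_normE !innerE (innerC b a); field. Qed.

(** The representative of l is the minimizer of |u|^2 - 2 l(u). *)
Lemma riesz (l : H -> R) (M : R) :
  {morph l : u v / u + v} -> (forall a u, l (a *: u) = a * l u) ->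
  (forall u, `|l u| <= M * `|u|) ->
  exists p, forall u, l u = '[p, u].
Proof.
move=> lD lZ lM.
have lB u v : l (u - v) = l u - l v by rewrite lD -scaleN1r lZ mulN1r.
have lc : continuous l.
  move=> u; apply/cvgrPdist_lt => e e0.
  have M0 : 0 < `|M| + 1 by rewrite ltr_wpDl.
  near=> v; rewrite -lB (le_lt_trans (lM _))//.
  rewrite (@le_lt_trans _ _ ((`|M| + 1) * `|u - v|))//.
    by rewrite ler_wpM2r// (le_trans (ler_norm _))// lerDl.
  rewrite -ltr_pdivlMl// mulrC; near: v.
  by apply: cvgr_dist_lt; [exact: cvg_id | rewrite divr_gt0].
have [|||//|u _|u v _ _|p _ pmin] := @strongly_midconvex_min setT
  (fun u => `|u| ^+ 2 - 2 * l u) (- (M ^+ 2)).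
- by exists 0.
- exact: closedT.
- move=> u; apply: cvgB; last by apply: cvgMr; exact: lc.
  rewrite expr2; under eq_fun do rewrite expr2.
  by apply: cvgM; apply: cvg_norm; exact: cvg_id.
- have := sqr_ge0 (`|u| - M).
  have := lM u; have := ler_norm (l u); nra.
- by rewrite norm_midpoint lZ lD; lra.
exists p => u.
pose c := '[p, u] - l u; pose q := '[u, u].
have q0 : 0 <= q by exact: inner_ge0.
have := pmin (p + (- c / (q + 1)) *: u) I.
(* A step along u that is short enough for the quadratic term s^2 |u|^2 not to
   compensate the first-order decrease 2 s c. *)
set s := - c / (q + 1).
rewrite lD lZ !sqr_normE !innerE (innerC u p) -/q => h.
have q1 : 0 < q + 1 by lra.
have es : s * (q + 1) = - c by rewrite /s divfK// lt0r_neq0.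
have : 0 <= s * (s * q + 2 * c) by rewrite /c; nra.
have -> : s * q = - c - s by rewrite -es; ring.
have -> : c = - (s * (q + 1)) by rewrite es opprK.
have -> : s * (- - (s * (q + 1)) - s + 2 * - (s * (q + 1)))
   = - ((q + 2) * s ^+ 2) by ring.
rewrite oppr_ge0 pmulr_rle0 ?ltr_wpDl// => s0.
have {}s0 : s = 0 by apply/eqP; rewrite -sqrf_eq0 eq_le s0 sqr_ge0.
by move: es; rewrite s0 mul0r /c; lra.
Unshelve. all: by end_near. Qed.

End minimizer.

(** * Metric projection *)

Section projection.
Context {R : realType} {H : hilbertType R}.
Implicit Types (u v w : H) (K : set H).

Lemma convex_set_segment K u v (s : R) : convex_set K -> 0 <= s <= 1 ->
  K u -> K v -> K (u + s *: (v - u)).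
Proof.
move=> Kco /andP[s0 s1] Ku Kv.
have := Kco v u (@Itv01 R s s0 s1) (mem_set Kv) (mem_set Ku).
rewrite inE; congr K; rewrite /conv/= /unstable.onem scalerBl scale1r scalerBr.
by rewrite addrCA.
Qed.

Lemma metric_proj_nearest K u : K !=set0 -> closed K -> convex_set K ->
  nearest_points K u (metric_proj K u).
Proof.
move=> K0 Kc Kco; rewrite /metric_proj.
have [|a b Ka Kb|a _|a b _ _|z Kz zmin] := @strongly_midconvex_min _ _ K
    (fun w => `|u - w| ^+ 2) 0 K0 Kc.
- move=> w; rewrite /continuous_at expr2; under eq_fun do rewrite expr2.
  by apply: cvgM; apply: cvg_norm; apply: cvgB => //; exact: cvg_cst.
- have := @convex_set_segment K a b 2^-1 Kco _ Ka Kb.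
  rewrite [X in K X](_ : _ = 2^-1 *: (a + b)); last first.
    have {1}-> : a = 2^-1 *: a + 2^-1 *: a.
      by rewrite -scalerDl (_ : 2^-1 + 2^-1 = 1 :> R) ?scale1r//; field.
    by rewrite scalerBr scalerDr addrACA subrr addr0.
  by apply; apply/andP; split; lra.
- exact: sqr_ge0.
- have -> : u - 2^-1 *: (a + b) = 2^-1 *: ((u - a) + (u - b)).
    rewrite addrACA -opprD scalerBr; congr (_ - _).
    by rewrite scalerDr -scalerDl (_ : 2^-1 + 2^-1 = 1 :> R) ?scale1r//; field.
  rewrite norm_midpoint [u - a - _](_ : _ = b - a) 1?[`|b - a|]distrC//.
  by rewrite opprB addrC addrA subrK.
- apply: (xgetPex 0); exists z; split => // w Kw.
  by rewrite -(@ler_pXn2r _ 2)// ?nnegrE//; exact: zmin.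
Qed.

Lemma metric_proj_in K u : K !=set0 -> closed K -> convex_set K ->
  K (metric_proj K u).
Proof. by move=> K0 Kc Kco; have [] := metric_proj_nearest K u K0 Kc Kco. Qed.

(** The variational characterization of the projection: the segment from the
projection to w cannot come closer to u. *)
Lemma metric_proj_obtuse K u w : K !=set0 -> closed K -> convex_set K ->
  K w -> '[u - metric_proj K u, w - metric_proj K u] <= 0.
Proof.
move=> K0 Kc Kco Kw; have [] := metric_proj_nearest K u K0 Kc Kco.
set z := metric_proj K u => Kz zmin.
suff : 2 * '[u - z, w - z] <= 0 by lra.
refine (@le0_of_small R _ (`|w - z| ^+ 2) _) => s s0 s1.
have Ks := @convex_set_segment K z w s Kco _ Kz Kw.
have {Ks}/zmin h : K (z + s *: (w - z)) by apply: Ks; rewrite (ltW s0) s1.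
have : `|u - z| ^+ 2 <= `|u - (z + s *: (w - z))| ^+ 2.
  by rewrite ler_pXn2r// nnegrE.
rewrite opprD addrA [leRHS]inner_sub_sqr.
rewrite innerZr normrZ exprMn real_normK ?num_real// => {}h.
rewrite -(ler_pM2l s0); nra.
Qed.

Lemma metric_proj_nonexp K u v : K !=set0 -> closed K -> convex_set K ->
  `|metric_proj K u - metric_proj K v| <= `|u - v|.
Proof.
move=> K0 Kc Kco.
have h1 := metric_proj_obtuse K u (metric_proj K v) K0 Kc Kco
  (metric_proj_in K v K0 Kc Kco).
have h2 := metric_proj_obtuse K v (metric_proj K u) K0 Kc Kco
  (metric_proj_in K u K0 Kc Kco).
move: h1 h2; set a := metric_proj K u; set b := metric_proj K v => h1 h2.
have : `|a - b| ^+ 2 <= '[u - v, a - b].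
  by move: h1 h2; rewrite sqr_normE !innerE; lra.
move=> /le_trans/(_ (inner_le_norm _ _)).
have [->|ab] := eqVneq (a - b) 0; first by rewrite normr0.
by rewrite expr2 ler_pM2r// normr_gt0.
Qed.

End projection.

(** * Weak sequential compactness *)

Section ultrafilters.

(** Ultrafilters replace the extraction of subsequences: a limit along G can be
tested along the ultrafilters finer than G, and along those every bounded
real family converges. *)
Lemma ultra_cvg {T : Type} {X : topologicalType} (f : T -> X)
    (G : set_system T) (l : X) : Filter G ->
  (forall V : set_system T, UltraFilter V -> G `<=` V -> f @ V --> l) ->
  f @ G --> l.
Proof.
move=> FG h A lA; apply: contrapT => nGA.
have WF : ProperFilter (within (~` (f @^-1` A)) G).
  split; last exact: within_filter.
  rewrite /within /= => W; apply: nGA; apply: filterS W => t /= nA.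
  by apply: contrapT => /nA.
have [V [VU GV]] := ultraFilterLemma WF.
have GV' : G `<=` V by move=> B GB; apply: GV; apply: filterS GB => t.
have := h V VU GV' _ lA.
have VnA : V (~` (f @^-1` A)).
  by apply: (GV (~` (f @^-1` A))); apply: withinT.
move=> VA; have {}VA : V (f @^-1` A) := VA.
by have [t []] := filter_ex (filterI VA VnA).
Qed.

Lemma bounded_ultra_cvg {R : realType} {T : Type} (f : T -> R) (B : R)
    (V : set_system T) : UltraFilter V -> (forall t, `|f t| <= B) ->
  cvg (f @ V).
Proof.
move=> VU fB.
have PF : ProperFilter (f @ V) by exact: fmap_proper_filter.
have [|c [_ cl]] := @segment_compact R (- B) B (f @ V) PF.
  by rewrite /fmap /=; apply: filterS filterT => t _ /=; rewrite in_itv/= -ler_norml.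
apply/cvg_ex; exists c => A cA.
have [//|VnA] := @in_ultra_setVsetC _ V (f @^-1` A) VU.
by have [x []] := cl (~` A) A VnA cA.
Qed.

End ultrafilters.

Section weak_convergence.
Context {R : realType} {H : hilbertType R}.
Implicit Types (u v w p : H).

Lemma weak_cvg_norm_le (G : set_system H) p (M : R) : ProperFilter G ->
  weak_cvg_to G p -> (\forall u \near G, `|u| <= M) -> `|p| <= M.
Proof.
move=> PG Gp GM.
have [->|p0] := eqVneq p 0.
  rewrite normr0; have [u] := filter_ex GM; exact: le_trans.
rewrite -(ler_pM2r (_ : 0 < `|p|)) ?normr_gt0// -expr2 sqr_normE.
apply: cvgr_to_le (Gp p) _; apply: filterS GM => u uM.
by rewrite (le_trans (inner_le_norm _ _))// ler_wpM2r.
Qed.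

(** Along an ultrafilter, all the functions <f t, z> converge at once, and the
limit is a bounded linear form of z. *)
Lemma bounded_ultra_weak_cvg {T : Type} (f : T -> H) (M : R)
    (V : set_system T) : UltraFilter V -> (forall t, `|f t| <= M) ->
  exists p, weak_cvg_to (f @ V) p.
Proof.
move=> VU fM.
have fMz z t : `|'[f t, z]| <= M * `|z|.
  by rewrite (le_trans (norm_inner_le _ _))// ler_wpM2r.
have cv z : cvg ('[f t, z] @[t --> V]) by exact: bounded_ultra_cvg (fMz z).
pose l z := lim ('[f t, z] @[t --> V]).
have lE z x : '[f t, z] @[t --> V] --> x -> l z = x by move/cvg_lim; apply.
have [|||p lp] := @riesz _ _ l M.
- move=> u v; apply: lE; under eq_fun do rewrite innerDr.
  by apply: cvgD; exact: cv.
- move=> a u; apply: lE; under eq_fun do rewrite innerZr.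
  by apply: cvgMr; exact: cv.
- move=> u; apply: cvgr_to_le (cvg_norm (cv u)) _.
  by apply: nearW => t; exact: fMz.
by exists p => z; rewrite -lp; exact: cv.
Qed.

(** Let p be the weak limit of u along an ultrafilter. The indices k n are
chosen so that <u (k n) - p, u i> tends to 0 for each i. This is enough: if q is
the limit of u (k n) along some ultrafilter, then q - p is orthogonal to all
the u i, hence to their weak limits p and q, and q = p. *)
Lemma bounded_weak_subsequence (u : nat -> H) (M : R) :
  (forall n, `|u n| <= M) ->
  exists (k : nat -> nat) p,
    (forall n, (n <= k n)%N) /\ weak_cvg_to (u (k n) @[n --> \oo]) p.
Proof.
move=> uM; have [U [UU oU]] := @ultraFilterLemma nat \oo _.
have [p up] := bounded_ultra_weak_cvg u M U UU uM.
have ex n : exists m, (n <= m)%N /\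
    forall i, (i <= n)%N -> `|'[u m - p, u i]| < n.+1%:R^-1.
  have e0 : 0 < n.+1%:R^-1 :> R by rewrite invr_gt0.
  suff near_i j : \forall m \near U,
      forall i, (i < j)%N -> `|'[u m - p, u i]| < n.+1%:R^-1.
    have Un : U [set m | (n <= m)%N] by apply: oU; exact: nbhs_infty_ge.
    by have [m [? h]] := filter_ex (filterI Un (near_i n.+1)); exists m.
  elim: j => [|j IH]; first by apply: filterS filterT.
  have /cvgrPdistC_lt/(_ _ e0) : '[u m, u j] @[m --> U] --> '[p, u j] := up (u j).
  apply: filter_app; apply: filterS IH => m IH hj i.
  rewrite ltnS leq_eqVlt => /orP[/eqP->|]; last exact: IH.
  by rewrite innerDl innerNl.
pose k n := projT1 (cid (ex n)).
have nk n : (n <= k n)%N by rewrite /k; case: cid => m [].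
have ki n i : (i <= n)%N -> `|'[u (k n) - p, u i]| < n.+1%:R^-1.
  by move=> ?; rewrite /k; case: cid => m [/= _]; exact.
exists k, p; split => // z.
apply: (@ultra_cvg nat _ (fun n => '[u (k n), z]) \oo) => V VU oV.
have [q uq] := bounded_ultra_weak_cvg (u \o k) M V VU (fun n => uM _).
suff -> : p = q by exact: uq.
have pq i : '[q - p, u i] = 0.
  have lim0 : '[u (k n) - p, u i] @[n --> V] --> (0 : R).
    apply/cvgr0Pnorm_lt => e e0; apply: oV.
    near=> n; rewrite (lt_trans (ki _ _ _))//.
      by near: n; exact: nbhs_infty_ge.
    by near: n; exact: (near_infty_natSinv_lt (PosNum e0)).
  have limq : '[u (k n) - p, u i] @[n --> V] --> '[q - p, u i].
    rewrite innerDl innerNl; under eq_fun do rewrite innerDl innerNl.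
    by apply: cvgB; [exact: uq | exact: cvg_cst].
  exact: (cvg_unique _ limq lim0).
have orth (W : set_system nat) (j : nat -> nat) r : ProperFilter W ->
    weak_cvg_to (u (j n) @[n --> W]) r -> '[q - p, r] = 0.
  move=> PW ur; rewrite innerC.
  have lim0 : '[u (j n), q - p] @[n --> W] --> (0 : R).
    under eq_fun do rewrite innerC pq; exact: cvg_cst.
  exact: (cvg_unique _ (ur (q - p)) lim0).
have pqp : '[q - p, p] = 0 by exact: (orth U id).
have pqq : '[q - p, q] = 0 by exact: (orth V k).
apply/esym/eqP; rewrite -subr_eq0; apply/eqP/inner_eq0.
by rewrite innerDr innerNr pqp pqq subrr.
Unshelve. all: by end_near. Qed.

End weak_convergence.

(** * Weak limit points of a trajectory *)

Lemma cvg_pinfty_of_ge_succ {R : realType} (t : nat -> R) :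
  (forall n, n.+1%:R <= t n) -> t n @[n --> \oo] --> +oo.
Proof.
move=> tn; apply/cvgryPge => A; near=> n; rewrite (le_trans _ (tn n))//.
rewrite (@le_trans _ _ n%:R)// ?ler_nat//; near: n.
exact: nbhs_infty_ger.
Unshelve. all: by end_near. Qed.

Section weak_omega_limit.
Context {R : realType} {H : hilbertType R}.
Implicit Types (x : R -> H) (u v w z p : H).

(** Passing to a subsequence, t_n >= n + 1 is no more than t_n --> +oo; it also
keeps the times in [1, +oo[, where the trajectory has two-sided derivatives. *)
Definition weak_omega_limit x : set H :=
  [set z | exists t : nat -> R, (forall n, n.+1%:R <= t n) /\
     weak_cvg_to (x (t n) @[n --> \oo]) z].

Lemma weak_omega_limit_subsequence x (M : R) (s : nat -> R) :
  (forall t, 1 <= t -> `|x t| <= M) -> (forall n, n.+1%:R <= s n) ->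
  exists (k : nat -> nat) z, weak_omega_limit x z /\
    weak_cvg_to (x (s (k n)) @[n --> \oo]) z.
Proof.
move=> xM sn.
have [n|k [z [kn kz]]] := @bounded_weak_subsequence _ _ (x \o s) M.
  by apply: xM; rewrite (le_trans _ (sn n))// ler1n.
exists k, z; split => //; exists (s \o k); split => // n.
by rewrite (le_trans _ (sn _))// ler_nat ltnS.
Qed.

Lemma weak_omega_limit_norm_le x (M : R) z :
  (forall t, 1 <= t -> `|x t| <= M) -> weak_omega_limit x z -> `|z| <= M.
Proof.
move=> xM [t [tn xt]]; apply: weak_cvg_norm_le xt _.
have tM n : `|x (t n)| <= M by apply: xM; rewrite (le_trans _ (tn n))// ler1n.
exact: (nearW (F := \oo) _ tM).
Qed.

Lemma weak_omega_limit_frequently x z v (e : R) n :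
  weak_omega_limit x z -> 0 < e ->
  exists2 t, n.+1%:R <= t & `|'[x t, v] - '[z, v]| < e.
Proof.
move=> [t [tn xt]] e0.
have /cvgrPdistC_lt/(_ _ e0) [N _ hN] :
  '[x (t n), v] @[n --> \oo] --> '[z, v] := xt v.
exists (t (maxn n N)); last by apply: hN => /=; exact: leq_maxr.
by rewrite (le_trans _ (tn _))// ler_nat ltnS leq_maxl.
Qed.

(** Times at which <x t, z> stays away from <z0, z> would have, by weak
compactness, a weak limit point other than z0. *)
Lemma weak_omega_limit_singleton x (M : R) z0 :
  (forall t, 1 <= t -> `|x t| <= M) ->
  (forall z, weak_omega_limit x z -> z = z0) ->
  weak_cvg_to (x t @[t --> +oo]) z0.
Proof.
move=> xM xz0 z.
suff : '[x t, z] @[t --> +oo] --> '[z0, z] by [].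
apply: contrapT => ncv.
have [e e0 he] : exists2 e : R, 0 < e &
    forall n : nat, exists2 t : R, n.+1%:R <= t & e <= `|'[x t, z] - '[z0, z]|.
  apply: contrapT => ne; apply: ncv; apply/cvgrPdistC_lt => e e0.
  apply: contrapT => nnear; apply: ne; exists e => // n.
  apply: contrapT => nn; apply: nnear.
  near=> t.
  have tn : n.+1%:R <= t by near: t; apply: nbhs_pinfty_ge; exact: num_real.
  by rewrite ltNge; apply/negP => et; apply: nn; exists t.
pose s n := s2val (cid2 (he n)).
have sn n : n.+1%:R <= s n by exact: (s2valP (cid2 (he n))).
have se n : e <= `|'[x (s n), z] - '[z0, z]| by exact: (s2valP' (cid2 (he n))).
have [k [z1 [/xz0 -> kz]]] := weak_omega_limit_subsequence x M s xM sn.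
have /cvgrPdistC_lt/(_ _ e0) [N _ hN] :
  '[x (s (k n)), z] @[n --> \oo] --> '[z0, z] := kz z.
by have := hN N (leqnn _); rewrite /= ltNge se.
Unshelve. all: by end_near. Qed.

(** The weak limit set is connected, as seen by a continuous linear form:
between the values at two weak limit points, the trajectory takes each
intermediate value c at arbitrarily large times, and a weak limit point of
these times has the value c. *)
Lemma weak_omega_limit_ivt x (M c : R) v z w :
  (forall t, 1 <= t -> `|x t| <= M) ->
  (forall t, 1 <= t -> {for t, continuous (fun t => '[x t, v])}) ->
  weak_omega_limit x z -> weak_omega_limit x w ->
  '[w, v] < c -> c < '[z, v] ->
  exists2 u, weak_omega_limit x u & '[u, v] = c.
Proof.
move=> xM xc xz xw wc cz.
have hs n : exists2 s : R, n.+1%:R <= s & '[x s, v] = c.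
  have cz0 : 0 < '[z, v] - c by rewrite subr_gt0.
  have wc0 : 0 < c - '[w, v] by rewrite subr_gt0.
  have [a an] := weak_omega_limit_frequently x z v _ n xz cz0.
  rewrite ltr_norml => /andP[za _].
  have [b bn] := weak_omega_limit_frequently x w v _ n xw wc0.
  rewrite ltr_norml => /andP[_ wb].
  have ha : c < '[x a, v] by lra.
  have hb : '[x b, v] < c by lra.
  have n1 : 1 <= n.+1%:R :> R by rewrite ler1n.
  have cab (l r : R) : n.+1%:R <= l ->
      {within `[l, r], continuous (fun t => '[x t, v])}.
    move=> nl; apply: continuous_in_subspaceT => t.
    by rewrite inE/= in_itv/= => /andP[lt _]; apply: xc; lra.
  have [ab|/ltW ba] := leP a b.
  - have [|t] := @IVT R _ _ _ c ab (cab a b an).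
      by rewrite ge_min le_max (ltW ha) (ltW hb) orbT.
    by rewrite in_itv/= => /andP[t1 _] tc; exists t => //; lra.
  - have [|t] := @IVT R _ _ _ c ba (cab b a bn).
      by rewrite ge_min le_max (ltW ha) (ltW hb) orbT.
    by rewrite in_itv/= => /andP[t1 _] tc; exists t => //; lra.
pose s n := s2val (cid2 (hs n)).
have sn n : n.+1%:R <= s n by exact: (s2valP (cid2 (hs n))).
have sc n : '[x (s n), v] = c by exact: (s2valP' (cid2 (hs n))).
have [k [u [xu ku]]] := weak_omega_limit_subsequence x M s xM sn.
exists u => //.
have limc : '[x (s (k n)), v] @[n --> \oo] --> c.
  under eq_fun do rewrite sc; exact: cvg_cst.
exact: (cvg_unique _ (ku v) limc).
Qed.

(** A set that is separated in norm can be connected for the weak topology only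
if it is a point: the slice cut near a point z0 of almost maximal norm has
small diameter, so z0 is weakly isolated. *)
Lemma separated_weak_omega_limit_cvg x (M d : R) : 0 < d ->
  (forall t, 1 <= t -> `|x t| <= M) ->
  (forall v t, 1 <= t -> {for t, continuous (fun t => '[x t, v])}) ->
  (forall z w, weak_omega_limit x z -> weak_omega_limit x w ->
     z != w -> d <= `|z - w|) ->
  exists2 z, weak_omega_limit x z & weak_cvg_to (x t @[t --> +oo]) z.
Proof.
move=> d0 xM xc sep.
have [_ [z1 [xz1 _]]] :=
  weak_omega_limit_subsequence x M (fun n => n.+1%:R) xM (fun n => lexx _).
pose S := [set `|z| ^+ 2 | z in weak_omega_limit x].
have hS : has_sup S.
  split; first by exists (`|z1| ^+ 2), z1.
  exists (M ^+ 2) => _ [z xz <-].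
  by rewrite lerXn2r ?nnegrE//; have := weak_omega_limit_norm_le x M z xM xz;
    [exact: le_trans | ].
have d4 : 0 < d ^+ 2 / 4 by rewrite divr_gt0 ?exprn_gt0.
have [_ [z0 xz0 <-] z0S] := sup_adherent d4 hS.
(* In the slice, |w - z0|^2 = |w|^2 - 2 <w, z0> + |z0|^2
   < |w|^2 - |z0|^2 + d^2 / 2 < d^2. *)
have slice w : weak_omega_limit x w ->
    `|z0| ^+ 2 - d ^+ 2 / 4 < '[w, z0] -> w = z0.
  move=> xw h; apply/eqP/negP => /negP wz0.
  have := sep _ _ xw xz0 wz0; apply/negP; rewrite -ltNge.
  rewrite -(@ltr_pXn2r _ 2)// ?nnegrE ?(ltW d0)// inner_sub_sqr.
  have : `|w| ^+ 2 <= sup S by apply: sup_upper_bound => //; exists w.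
  by move: z0S h; rewrite -/S; lra.
exists z0 => //; apply: (@weak_omega_limit_singleton _ M) => // w xw.
apply: contrapT => wz0.
have wle : '[w, z0] <= `|z0| ^+ 2 - d ^+ 2 / 4.
  by rewrite leNgt; apply/negP => /(slice _ xw).
pose c := `|z0| ^+ 2 - d ^+ 2 / 8.
have [||u xu uc] := weak_omega_limit_ivt x M c z0 z0 w xM (xc z0) xz0 xw.
- by apply: le_lt_trans wle _; rewrite /c; lra.
- by rewrite -sqr_normE /c; lra.
have uz0 : u = z0 by apply: slice xu _; rewrite uc /c; lra.
by move: uc; rewrite uz0 -sqr_normE /c; lra.
Qed.

(** Opial's argument: the difference of the two square distances is affine in
x t, so <x t, z - w> converges, and its limit can be computed at both z and
w. *)
Lemma opial_unique x z w (l m : R) :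
  weak_omega_limit x z -> weak_omega_limit x w ->
  `|x t - z| ^+ 2 @[t --> +oo] --> l -> `|x t - w| ^+ 2 @[t --> +oo] --> m ->
  z = w.
Proof.
move=> xz xw hl hm.
have hd : 2 * '[x t, z - w] @[t --> +oo] --> m - l + `|z| ^+ 2 - `|w| ^+ 2.
  have -> : (fun t => 2 * '[x t, z - w]) =
      (fun t => `|x t - w| ^+ 2 - `|x t - z| ^+ 2 + `|z| ^+ 2 - `|w| ^+ 2).
    by apply/funext => t; rewrite !inner_sub_sqr !innerE; ring.
  by apply: cvgB; [apply: cvgD; [exact: cvgB|]|]; exact: cvg_cst.
have at_pt p : weak_omega_limit x p ->
    2 * '[p, z - w] = m - l + `|z| ^+ 2 - `|w| ^+ 2.
  move=> [t [tn xt]].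
  have tpinfty := cvg_pinfty_of_ge_succ t tn.
  have h1 : 2 * '[x (t n), z - w] @[n --> \oo] --> 2 * '[p, z - w].
    by apply: cvgMr; exact: xt.
  have h2 := cvg_comp _ _ tpinfty hd.
  exact: (cvg_unique _ h1 h2).
apply/eqP; rewrite -subr_eq0; apply/eqP/inner_eq0.
rewrite {1}innerDl innerNl.
by have := at_pt _ xz; have := at_pt _ xw; lra.
Qed.

End weak_omega_limit.

(** * Differentiable curves *)

Lemma cvg_near_eq {T : Type} {X : topologicalType} (G : set_system T)
    (f g : T -> X) (l : X) : Filter G ->
  (\forall t \near G, f t = g t) -> f @ G --> l -> g @ G --> l.
Proof.
move=> FG fg fl; apply: cvg_trans fl; apply: near_eq_cvg.
by apply: filterS fg => t.
Qed.

Section derivatives.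
Context {R : realType} {H : hilbertType R}.
Implicit Types (f : R -> H) (t : R) (g z : H).

Lemma is_derive_quotient {W : normedModType R} (f : R -> W) t (g : W) :
  is_derive t 1 f g <-> h^-1 *: (f (t + h) - f t) @[h --> 0^'] --> g.
Proof.
have -> : (fun h : R => h^-1 *: (f (t + h) - f t)) =
    (fun h : R => h^-1 *: ((f \o shift t) (h *: (1 : R)) - f t)).
  by apply/funext => h /=; rewrite [h *: 1]mulr1 (addrC h).
split => [[df <-]|dg]; first exact: df.
by split; [apply/cvg_ex; exists g | exact: cvg_lim].
Qed.

Lemma is_derive_cvg_shift f t g : is_derive t 1 f g ->
  f (t + h) @[h --> 0^'] --> f t.
Proof.
move=> /is_derive_quotient dfg.
have h0 : h @[h --> (0 : R)^'] --> (0 : R) by apply: cvg_within.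
have c : h *: (h^-1 *: (f (t + h) - f t)) + f t @[h --> 0^'] --> f t.
  rewrite -[X in _ --> X]add0r -(scale0r g).
  by apply: cvgD; [exact: cvgZ | exact: cvg_cst].
apply: cvg_near_eq c; near=> h.
have hn0 : h != 0 by near: h; exact: nbhs_dnbhs_neq.
by rewrite scalerA mulfV// scale1r subrK.
Unshelve. all: by end_near. Qed.

Lemma is_derive_inner f t g z : is_derive t 1 f g ->
  is_derive t 1 (fun s => '[f s, z]) '[g, z].
Proof.
move=> /is_derive_quotient dfg; apply/is_derive_quotient.
have c : '[h^-1 *: (f (t + h) - f t), z] @[h --> 0^'] --> '[g, z].
  by apply: cvg_inner; [exact: dfg | exact: cvg_cst].
apply: cvg_near_eq c; apply: nearW => h.
by rewrite !innerE.
Qed.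

Lemma is_derive_sqr_dist f t g z : is_derive t 1 f g ->
  is_derive t 1 (fun s => `|f s - z| ^+ 2) (2 * '[g, f t - z]).
Proof.
move=> df; have /is_derive_quotient dfg := df; apply/is_derive_quotient.
have fz : f (t + h) - z + (f t - z) @[h --> 0^'] --> (f t - z) + (f t - z).
  apply: cvgD; last exact: cvg_cst.
  by apply: cvgB; [exact: is_derive_cvg_shift df|exact: cvg_cst].
have c : '[h^-1 *: (f (t + h) - f t), f (t + h) - z + (f t - z)] @[h --> 0^']
    --> 2 * '[g, f t - z].
  by rewrite mulr_natl mulr2n -innerDr; apply: cvg_inner; [exact: dfg|].
apply: cvg_near_eq c; apply: nearW => h.
rewrite !sqr_normE !innerE (innerC (f t) (f (t + h))) (innerC z (f t)).
by rewrite (innerC z (f (t + h))) /GRing.scale/=; ring.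
Qed.

Lemma is_derive_continuous (f : R -> R) t d :
  is_derive t 1 f d -> {for t, continuous f}.
Proof. by move=> [df _]; apply/differentiable_continuous/derivable1_diffP. Qed.

Lemma mvt_ray (f df : R -> R) (a s t : R) : a <= s -> s <= t ->
  (forall r, a <= r -> is_derive r 1 f (df r)) ->
  exists r, [/\ s <= r, r <= t & f t - f s = df r * (t - s)].
Proof.
move=> as_ st dfr.
have [r||r] := @MVT_segment R f df s t st.
- by rewrite in_itv/= => /andP[sr _]; apply: dfr; lra.
- apply: continuous_in_subspaceT => r; rewrite inE/= in_itv/= => /andP[sr _].
  by apply: (@is_derive_continuous f r (df r)); apply: dfr; lra.
- by rewrite in_itv/= => /andP[sr rt] E; exists r.
Qed.

(** The mean value theorem applied to the component of f along f t - f s. *)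
Lemma speed_bound_lipschitz f (df : R -> H) (a M : R) :
  (forall r, a <= r -> is_derive r 1 f (df r)) ->
  (forall r, a <= r -> `|df r| <= M) ->
  forall s t, a <= s -> s <= t -> `|f t - f s| <= M * (t - s).
Proof.
move=> dfr dM s t as_ st; set v := f t - f s.
have [r|r [sr rt]] := @mvt_ray (fun r => '[f r, v]) (fun r => '[df r, v])
  a s t as_ st; first by move=> ar; apply: is_derive_inner; exact: dfr.
rewrite -innerNl -innerDl -/v -sqr_normE => vE.
have [->|v0] := eqVneq v 0.
  rewrite normr0 mulr_ge0 ?subr_ge0//.
  by apply: le_trans (dM a (lexx _)).
rewrite -(@ler_pM2r _ `|v|) ?normr_gt0// -expr2 vE mulrAC.
rewrite ler_wpM2r ?subr_ge0// (le_trans (inner_le_norm _ _))// ler_wpM2r//.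
by apply: dM; lra.
Qed.

Lemma nonincreasing_bounded_cvg_pinfty (V : R -> R) (a : R) :
  (forall t, 0 <= V t) -> (forall s t, a <= s -> s <= t -> V t <= V s) ->
  exists l : R, V t @[t --> +oo] --> l.
Proof.
move=> V0 Vmono; pose S := [set V t | t in [set t | a <= t]].
have hS : has_inf S.
  by split; [exists (V a), a => /= | exists 0 => _ [t _ <-]].
exists (inf S); apply/cvgrPdistC_lt => e e0.
have [_ [t /= at_ <-] te] := inf_adherent e0 hS.
near=> s.
have ts : t <= s by near: s; apply: nbhs_pinfty_ge; exact: num_real.
have Vs : inf S <= V s.
  by apply: ge_inf; [exact: hS.2 | exists s => //=; lra].
have Vst := Vmono _ _ at_ ts.
rewrite ltr_norml; apply/andP; split; lra.
Unshelve. all: by end_near. Qed.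

End derivatives.

(** * The forward-backward-forward flow *)

Section forward_backward_forward.
Context {R : realType} {H : hilbertType R}.
Context (K : set H) (F : H -> H) (L lambda : R).
Context (K_nonempty : K !=set0) (K_closed : closed K) (K_convex : convex_set K).
Context (L_gt0 : 0 < L) (F_lip : forall u v, `|F u - F v| <= L * `|u - v|).
Context (lambda_gt0 : 0 < lambda) (lambdaL_lt1 : lambda * L < 1).
Implicit Types u v w p z : H.

Definition fb_step u := metric_proj K (u - lambda *: F u).

Definition fbf_field u := fb_step u + lambda *: (F u - F (fb_step u)) - u.

Definition residual u := u - fb_step u.

Lemma residual_lipschitz u v : `|residual u - residual v| <= 3 * `|u - v|.
Proof.
have h : `|fb_step u - fb_step v| <= `|u - v| + lambda * (L * `|u - v|).
  apply: le_trans (metric_proj_nonexp _ _ _ K_nonempty K_closed K_convex) _.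
  have -> : u - lambda *: F u - (v - lambda *: F v) =
      (u - v) - lambda *: (F u - F v).
    by rewrite scalerBr !opprB addrACA [RHS]addrACA [- v + _]addrC.
  rewrite (le_trans (ler_normB _ _))// lerD2l normrZ gtr0_norm//.
  by rewrite ler_pM2l.
have -> : residual u - residual v = (u - v) - (fb_step u - fb_step v).
  by rewrite /residual !opprB addrACA [RHS]addrACA [- v + _]addrC.
rewrite (le_trans (ler_normB _ _))//.
have : lambda * (L * `|u - v|) <= `|u - v| by rewrite mulrA ler_piMl// ltW.
by move: h; lra.
Qed.

Lemma fbf_fieldE u :
  fbf_field u = - (residual u - lambda *: (F u - F (fb_step u))).
Proof. by rewrite /fbf_field /residual !opprB addrA addrAC addrC addrA. Qed.

Lemma fbf_field_norm u : `|fbf_field u| <= 2 * `|residual u|.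
Proof.
rewrite fbf_fieldE normrN (le_trans (ler_normB _ _))//.
rewrite normrZ gtr0_norm//.
have lip : lambda * `|F u - F (fb_step u)| <= lambda * (L * `|residual u|).
  by rewrite ler_pM2l//; exact: F_lip.
have : lambda * (L * `|residual u|) <= `|residual u| by rewrite mulrA ler_piMl// ltW.
by move: lip; lra.
Qed.

(** Split <f(u), u - p> as <f(u), r(u)> + <f(u), y(u) - p>. The first part is at
most - (1 - lambda L) |r(u)|^2 by the Lipschitz bound, and the second one is at
most - lambda <F (y(u)), y(u) - p> <= 0 by the obtuse angle property. *)
Lemma fbf_field_descent p u : dual_VI_sol F K p ->
  '[fbf_field u, u - p] <= - (1 - lambda * L) * `|residual u| ^+ 2.
Proof.
move=> [Kp dualp].
have Ky : K (fb_step u) by exact: metric_proj_in.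
have obt := metric_proj_obtuse K (u - lambda *: F u) p K_nonempty K_closed
  K_convex Kp.
rewrite -/(fb_step u) in obt.
have mono := dualp _ Ky.
have lip : '[F u - F (fb_step u), residual u] <= L * `|residual u| ^+ 2.
  by rewrite (le_trans (inner_le_norm _ _))// expr2 mulrA ler_wpM2r//.
have {}mono := mulr_ge0 (ltW lambda_gt0) mono.
have {}lip : lambda * '[F u - F (fb_step u), residual u] <=
    lambda * (L * `|residual u| ^+ 2) by rewrite ler_pM2l.
have sq : `|residual u| ^+ 2 = '[residual u, residual u] by rewrite sqr_normE.
rewrite mulNr mulrBl mul1r -mulrA {1}sq.
move: obt mono lip; rewrite /fbf_field sq /residual.
move: (L * _) => LL.
by rewrite !innerE; lra.
Qed.

(** Minty's argument: test p at p + s (w - p), divide by s, let s tend to 0. *)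
Lemma dual_VI_sol_sub : dual_VI_sol F K `<=` VI_sol F K.
Proof.
move=> p [Kp dualp]; split => // w Kw.
rewrite -oppr_le0.
refine (@le0_of_small R _ (L * `|w - p| ^+ 2) _) => s s0 s1.
have Kq := @convex_set_segment R H K p w s K_convex _ Kp Kw.
have {}Kq : K (p + s *: (w - p)) by apply: Kq; rewrite (ltW s0) s1.
have := dualp _ Kq.
rewrite [p + _ - p]addrC addKr innerZr pmulr_rge0// => Fq.
have : '[F (p + s *: (w - p)) - F p, w - p] <= s * (L * `|w - p| ^+ 2).
  rewrite (le_trans (inner_le_norm _ _))// expr2 !mulrA ler_wpM2r//.
  rewrite (le_trans (F_lip _ _))// [p + _ - p]addrC addKr normrZ gtr0_norm//.
  by rewrite mulrA [L * s]mulrC.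
by rewrite innerDl innerNl; lra.
Qed.

Section trajectory.
Context (x : R -> H).
Context (dx : forall t : R, 1 <= t -> is_derive t 1 x (fbf_field (x t))).

Lemma trajectory_sqr_dist_decrease p s t (e : R) : dual_VI_sol F K p ->
  1 <= s -> s <= t -> 0 <= e ->
  (forall r, s <= r -> r <= t -> e <= `|residual (x r)|) ->
  `|x t - p| ^+ 2 <= `|x s - p| ^+ 2 - 2 * (1 - lambda * L) * e ^+ 2 * (t - s).
Proof.
move=> dp s1 st e0 er.
have [r r1|r [sr rt]] := @mvt_ray R (fun r => `|x r - p| ^+ 2)
    (fun r => 2 * '[fbf_field (x r), x r - p]) 1 s t s1 st.
  by apply: is_derive_sqr_dist; exact: dx.
have := fbf_field_descent p (x r) dp.
have : e ^+ 2 <= `|residual (x r)| ^+ 2 by rewrite ler_pXn2r ?nnegrE// er.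
set q := `|residual (x r)| ^+ 2; set d := '[_, _]; move=> eq dq E.
have {}dq : d <= - (1 - lambda * L) * e ^+ 2.
  by apply: le_trans dq _; rewrite !mulNr lerN2 ler_pM2l// subr_gt0.
have ts0 : 0 <= t - s by rewrite subr_ge0.
have := ler_wpM2r ts0 dq; lra.
Qed.

Lemma trajectory_dist_nonincreasing p s t : dual_VI_sol F K p ->
  1 <= s -> s <= t -> `|x t - p| ^+ 2 <= `|x s - p| ^+ 2.
Proof.
move=> dp s1 st.
have := trajectory_sqr_dist_decrease p s t 0 dp s1 st (lexx _)
  (fun _ _ _ => normr_ge0 _).
by rewrite expr0n/= mulr0 mul0r subr0.
Qed.

Lemma trajectory_dist_cvg p : dual_VI_sol F K p ->
  exists l : R, `|x t - p| ^+ 2 @[t --> +oo] --> l.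
Proof.
move=> dp; apply: (@nonincreasing_bounded_cvg_pinfty R _ 1) => [t|s t].
  exact: sqr_ge0.
exact: trajectory_dist_nonincreasing.
Qed.

Lemma trajectory_bounded p : dual_VI_sol F K p ->
  forall t, 1 <= t -> `|x t| <= `|x 1 - p| + `|p|.
Proof.
move=> dp t t1; rewrite -[x t](subrK p) (le_trans (ler_normD _ _))// lerD2r.
rewrite -(@ler_pXn2r _ 2)// ?nnegrE//.
exact: trajectory_dist_nonincreasing.
Qed.

(** Once |x(t) - p|^2 is within eta of its limit, it can no longer lose eta;
but it would, on an interval of length h, if |r(x(t))| were larger than e. *)
Lemma trajectory_residual_cvg0 p : dual_VI_sol F K p ->
  residual (x t) @[t --> +oo] --> (0 : H).
Proof.
move=> dp; pose B := `|residual p| + 3 * `|x 1 - p|.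
have resB t : 1 <= t -> `|residual (x t)| <= B.
  move=> t1; rewrite -[residual (x t)](subrK (residual p)).
  rewrite (le_trans (ler_normD _ _))// addrC lerD2l.
  rewrite (le_trans (residual_lipschitz _ _))// ler_pM2l//.
  rewrite -(@ler_pXn2r _ 2)// ?nnegrE//.
  exact: trajectory_dist_nonincreasing.
have B0 : 0 <= B by rewrite addr_ge0 ?mulr_ge0.
have speed s t : 1 <= s -> s <= t ->
    `|residual (x t) - residual (x s)| <= (6 * B) * (t - s).
  move=> s1 st; rewrite (le_trans (residual_lipschitz _ _))//.
  have dM r : 1 <= r -> `|fbf_field (x r)| <= 2 * B.
    by move=> r1; rewrite (le_trans (fbf_field_norm _))// ler_pM2l// resB.
  have := speed_bound_lipschitz _ _ 1 (2 * B) dx dM s t s1 st.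
  by move: (`|x t - x s|) => d; lra.
apply/cvgr0Pnorm_le => e e0.
have [l Vl] := trajectory_dist_cvg p dp.
(* During a time h the residual, which is (6 B)-Lipschitz in time, changes by at
   most e / 2; eta is half of the decrease forced by |r(x)| >= e / 2. *)
have B1 : 0 < 6 * B + 1 by lra.
pose h := e / (2 * (6 * B + 1)).
have h0 : 0 < h by rewrite divr_gt0// mulr_gt0.
have hB : (6 * B) * h <= e / 2.
  have -> : e / 2 = (6 * B + 1) * h.
    by rewrite /h; move: (6 * B + 1) B1 => c c0; field; exact: lt0r_neq0.
  by rewrite ler_pM2r//; lra.
pose eta := (1 - lambda * L) * (e / 2) ^+ 2 * h.
have eta0 : 0 < eta.
  have e2 : 0 < (e / 2) ^+ 2 by rewrite exprn_gt0 ?divr_gt0.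
  by apply: mulr_gt0 => //; apply: mulr_gt0; rewrite ?subr_gt0.
have /cvgrPdistC_lt/(_ _ eta0) [A [_ hA]] := Vl.
near=> t.
have t1 : 1 <= t by near: t; apply: nbhs_pinfty_ge; exact: num_real.
have At : A < t by near: t; apply: nbhs_pinfty_gt; exact: num_real.
rewrite leNgt; apply/negP => et.
have th : t <= t + h by rewrite lerDl ltW.
have Ath : A < t + h by lra.
have := hA t At; have := hA (t + h) Ath.
rewrite /= !ltr_norml => /andP[V1 _] /andP[_ V2].
have := trajectory_sqr_dist_decrease p t (t + h) (e / 2) dp t1 th.
have e2 : 0 <= e / 2 by rewrite divr_ge0// ltW.
move=> /(_ e2) V3.
have {}V3 := V3 _.
rewrite [t + h]addrC addrK in V3.
have resr r : t <= r -> r <= h + t -> e / 2 <= `|residual (x r)|.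
  move=> tr rt.
  have := speed t r t1 tr; have := lerB_dist (residual (x t)) (residual (x r)).
  rewrite distrC => h1 h2.
  have : (6 * B) * (r - t) <= (6 * B) * h by rewrite ler_wpM2l//; lra.
  lra.
have := V3 resr; move: V1 V2; rewrite [t + h]addrC /eta; lra.
Unshelve. all: by end_near. Qed.

End trajectory.
End forward_backward_forward.

(** * Weak limits of approximate solutions *)

Section weak_limits.
Context {R : realType} {H : hilbertType R}.

Lemma weak_cvg_sub_strong {T : Type} (G : set_system T) (f g : T -> H) p :
  Filter G -> weak_cvg_to (f t @[t --> G]) p -> g t @[t --> G] --> (0 : H) ->
  weak_cvg_to (f t - g t @[t --> G]) p.
Proof.
move=> FG fp g0 z.
suff : '[f t - g t, z] @[t --> G] --> '[p, z] by [].
rewrite -['[p, z]]subr0 -(linear0l inner z).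
under eq_fun do rewrite innerDl innerNl.
apply: cvgB; first exact: fp.
by apply: cvg_inner; [exact: g0 | exact: cvg_cst].
Qed.

(** The closed half-space bounded by the hyperplane through P_K p orthogonal to
p - P_K p contains K and is weakly closed; it contains p only if p = P_K p. *)
Lemma convex_closed_weakly_closed (K : set H) (G : set_system H) p :
  ProperFilter G -> K !=set0 -> closed K -> convex_set K ->
  (\forall u \near G, K u) -> weak_cvg_to G p -> K p.
Proof.
move=> PG K0 Kc Kco GK Gp.
suff -> : p = metric_proj K p by exact: metric_proj_in.
apply/eqP; rewrite -subr_eq0; apply/eqP/inner_eq0.
set q := metric_proj K p; rewrite {1}innerDl innerNl subr_le0.
have lim : '[u, p - q] @[u --> G] --> '[p, p - q] := Gp (p - q).
apply: (cvgr_to_le lim).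
apply: filterS GK => u Ku.
have := metric_proj_obtuse K p u K0 Kc Kco Ku.
by rewrite -/q innerC innerDl innerNl subr_le0.
Qed.

End weak_limits.

Lemma near_lt_limn_einf {R : realType} (v : (\bar R)^nat) (r : \bar R) :
  (r < limn_einf v)%E -> \forall n \near \oo, (r < v n)%E.
Proof.
rewrite limn_einf_lim (cvg_lim _ (@cvg_einfs_sup _ v))// => /ereal_sup_gt.
move=> [_ [N _ <-] rN]; exists N => // n /= Nn.
by apply: lt_le_trans rN _; apply: ereal_inf_lbound; exists n.
Qed.

Section weak_limits_of_approximate_solutions.
Context {R : realType} {H : hilbertType R}.
Context (K : set H) (F : H -> H) (L lambda : R).
Context (K_nonempty : K !=set0) (K_closed : closed K) (K_convex : convex_set K).
Context (L_gt0 : 0 < L) (F_lip : forall u v, `|F u - F v| <= L * `|u - v|).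
Context (lambda_gt0 : 0 < lambda).
Context (F_quasi : quasimonotone_on setT F) (F_lsc : norm_weakly_lsc F).
Context (u : nat -> H) (z : H) (M : R).
Context (uM : forall n, `|u n| <= M).
Context (uz : weak_cvg_to (u n @[n --> \oo]) z).
Context (ru : residual K F lambda (u n) @[n --> \oo] --> (0 : H)).

(** A point with small residual solves the variational inequality up to a small
error: this is the obtuse angle property of the projection at v - lambda F v. *)
Lemma residual_inner_lower_bound v w : K w ->
  - (`|residual K F lambda v| *
     (`|w - fb_step K F lambda v| + lambda * `|F v|)) <= lambda * '[F v, w - v].
Proof.
move=> Kw; set y := fb_step K F lambda v; set r := residual K F lambda v.
have obt : '[r - lambda *: F v, w - y] <= 0.
  have := metric_proj_obtuse K (v - lambda *: F v) w K_nonempty K_closed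
    K_convex Kw.
  by rewrite -/(fb_step K F lambda v) -/y addrAC.
have h1 : - (`|r| * `|w - y|) <= '[r, w - y].
  by rewrite lerNl -innerNl -(normrN r) inner_le_norm.
have h2 : lambda * '[F v, r] <= lambda * (`|F v| * `|r|).
  by rewrite ler_pM2l// inner_le_norm.
have -> : w - v = (w - y) - r by rewrite opprB addrA subrK.
move: obt; rewrite innerDl innerNl innerZl innerDr innerNr.
by move: h1 h2; lra.
Qed.

Lemma approximate_weak_limit_in : K z.
Proof.
have yz : weak_cvg_to (u n - residual K F lambda (u n) @[n --> \oo]) z.
  exact: weak_cvg_sub_strong uz ru.
refine (convex_closed_weakly_closed _ _ _ _ K_nonempty K_closed K_convex _ yz).
have Ky n : K (u n - residual K F lambda (u n)).
  by rewrite opprB addrC subrK; exact: metric_proj_in.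
exact: (nearW (F := \oo) _ Ky).
Qed.

(** For w in K and e > 0, [residual_inner_lower_bound] gives
<F (u n), w - u n> > - e for large n. With d = F (u n) / |F (u n)|^2, the shift w' = w + e d turns this into
<F (u n), w' - u n> > 0, and quasimonotonicity gives <F w', w' - u n> >= 0.
Since F (u n) stays away from 0, |d| is bounded independently of n and e, so w'
can be replaced by w at a cost of order e. *)
Lemma approximate_weak_limit_dual : F z != 0 -> dual_VI_sol F K z.
Proof.
move=> Fz0; split => [|w Kw]; first exact: approximate_weak_limit_in.
pose m := `|F z| / 2.
have m0 : 0 < m by rewrite divr_gt0 ?normr_gt0.
have M0 : 0 <= M by exact: le_trans (uM 0).
have near_m : \forall n \near \oo, m < `|F (u n)|.
  have : (m%:E < limn_einf (fun n => `|F (u n)|%:E))%E.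
    apply: lt_le_trans (F_lsc _ _ uz); rewrite lte_fin /m.
    by have := m0; rewrite /m; lra.
  by move/near_lt_limn_einf; apply: filterS => n; rewrite lte_fin.
pose BF := `|F 0| + L * M.
have FM n : `|F (u n)| <= BF.
  rewrite -[F (u n)](subrK (F 0)) addrC (le_trans (ler_normD _ _))// lerD2l.
  by rewrite (le_trans (F_lip _ _))// subr0 ler_pM2l.
pose B := `|w| + M + 1 + lambda * BF.
have B0 : 0 < B.
  have : 0 <= lambda * BF.
    by rewrite mulr_ge0 ?(ltW lambda_gt0)//; exact: le_trans (FM 0%N).
  by rewrite /B; have := normr_ge0 w; lra.
pose C := (L * (`|w| + M + m^-1) + `|F w|) / m.
rewrite -oppr_le0.
refine (@le0_of_small R _ C _) => e e0 e1.
have e'0 : 0 < Num.min 1 (lambda * e / B).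
  by rewrite lt_min ltr01 divr_gt0// mulr_gt0.
have /cvgr0Pnorm_lt/(_ _ e'0) near_r := ru.
have lim : - '[F w, w - u n] @[n --> \oo] --> - '[F w, w - z].
  apply: cvgN; rewrite innerC innerDl innerNl.
  under eq_fun do rewrite innerC innerDl innerNl.
  by apply: cvgB; [exact: cvg_cst | exact: uz].
apply: (cvgr_to_le lim); near=> n.
have mF : m < `|F (u n)| by near: n.
have : `|residual K F lambda (u n)| < Num.min 1 (lambda * e / B) by near: n.
rewrite lt_min => /andP[r1 re].
set v := u n in mF r1 re *; set r := residual K F lambda v in r1 re *.
have rB : `|r| * (`|w - fb_step K F lambda v| + lambda * `|F v|) < lambda * e.
  apply: (@le_lt_trans _ _ (`|r| * B)); last by rewrite -ltr_pdivlMr.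
  rewrite ler_wpM2l// /B lerD// ?ler_pM2l//; last exact: FM.
  have -> : w - fb_step K F lambda v = w - v + r by rewrite addrA subrK.
  rewrite (le_trans (ler_normD _ _))// lerD// ?(ltW r1)//.
  by rewrite (le_trans (ler_normB _ _))// lerD2l uM.
have Fvw : 0 < '[F v, w - v] + e.
  rewrite -(pmulr_rgt0 _ lambda_gt0) mulrDr.
  by have := residual_inner_lower_bound v w Kw; rewrite -/r; lra.
have Fv0 : 0 < `|F v| by exact: lt_trans mF.
pose d := (`|F v| ^+ 2)^-1 *: F v.
have Fvd : '[F v, d] = 1.
  by rewrite innerZr -sqr_normE mulVf// lt0r_neq0// exprn_gt0.
have d_le : `|d| <= m^-1.
  rewrite normrZ normfV normrX normr_id expr2 invfM mulfVK ?lt0r_neq0//.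
  by rewrite lef_pV2 ?posrE// ltW.
pose w' := w + e *: d.
have ww' : `|w' - w| <= e * m^-1.
  by rewrite /w' addrC addKr normrZ gtr0_norm// ler_pM2l.
have : 0 <= '[F w', w' - v].
  apply: F_quasi => //; rewrite /w' addrAC innerDr innerZr Fvd mulr1.
  exact: Fvw.
have w'v : `|w' - v| <= `|w| + M + m^-1.
  have -> : w' - v = (w - v) + (w' - w) by rewrite [RHS]addrC addrA subrK.
  rewrite (le_trans (ler_normD _ _))// lerD//.
    by rewrite (le_trans (ler_normB _ _))// lerD2l uM.
  by rewrite (le_trans ww')// ler_piMl// invr_ge0 ltW.
have h1 : '[F w' - F w, w' - v] <= L * (e * m^-1) * (`|w| + M + m^-1).
  rewrite (le_trans (inner_le_norm _ _))// ler_pM//.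
  by rewrite (le_trans (F_lip _ _))// ler_pM2l.
have h2 : '[F w, w' - w] <= `|F w| * (e * m^-1).
  by rewrite (le_trans (inner_le_norm _ _))// ler_wpM2l.
have -> : e * C = L * (e * m^-1) * (`|w| + M + m^-1) + `|F w| * (e * m^-1).
  by rewrite /C; ring.
by move: h1 h2; rewrite !innerDl !innerNl !innerDr !innerNr; lra.
Unshelve. all: by end_near. Qed.

End weak_limits_of_approximate_solutions.

(** * Weak convergence of the trajectory *)

Theorem proposition3p7 (R : realType) (H : hilbertType R) (K : set H)
    (F : H -> H) (L lambda : R) (x0 : H) (x y : R -> H)
    (K_nonempty : K !=set0) (K_closed : closed K) (K_convex : convex_set K)
    (C1 : dual_VI_sol F K !=set0)
    (L_gt0 : 0 < L)
    (C2_quasimonotone : quasimonotone_on setT F)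
    (C2_lipschitz : L.-lipschitz F)
    (C3 : norm_weakly_lsc F)
    (C4 : zeros_separated F K)
    (lambda_gt0 : 0 < lambda) (lambda_lt : lambda < 1 / L)
    (xy_trajectory : FBF_trajectory F K lambda x0 x y) :
  exists p, [/\ VI_sol F K p,
    weak_cvg_to (x t @[t --> +oo]) p &
    weak_cvg_to (y t @[t --> +oo]) p].
Proof.
have F_lip u v : `|F u - F v| <= L * `|u - v| by exact: (C2_lipschitz (u, v)).
have lambdaL : lambda * L < 1 by rewrite -ltr_pdivlMr.
have [yE [_ _ dx]] := xy_trajectory.
have {}dx (t : R) : 1 <= t -> is_derive t 1 x (fbf_field K F lambda (x t)).
  move=> t1; have t0 : 0 < t by exact: lt_le_trans t1.
  by have := dx t t0; rewrite yE ?(ltW t0).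
have [p0 dp0] := C1.
pose M := `|x 1 - p0| + `|p0|.
have xM t : 1 <= t -> `|x t| <= M.
  exact: (trajectory_bounded K F L lambda).
have res0 : residual K F lambda (x t) @[t --> +oo] --> (0 : H).
  exact: (trajectory_residual_cvg0 K F L lambda) dp0.
have omega z : weak_omega_limit x z ->
    K z /\ (F z = 0 \/ dual_VI_sol F K z).
  move=> [t [tn tz]].
  have tM n : `|x (t n)| <= M by apply: xM; rewrite (le_trans _ (tn n))// ler1n.
  have tpinfty := cvg_pinfty_of_ge_succ t tn.
  have rt : residual K F lambda (x (t n)) @[n --> \oo] --> (0 : H).
    exact: cvg_comp _ _ tpinfty res0.
  split.
    exact: (approximate_weak_limit_in K F lambda _ _ _ _ _ tz rt).
  have [->|Fz0] := eqVneq (F z) 0; [by left|right].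
  exact: (approximate_weak_limit_dual K F L lambda _ _ _ _ _ _ _ _ _ _ M tM tz rt).
(* If no weak limit point is in Omega_D, any point of Omega_D will do. *)
have [p [dp omega_p]] : exists p, dual_VI_sol F K p /\
    forall z, weak_omega_limit x z -> dual_VI_sol F K z -> z = p.
  have [[p [xp dp]]|nop] :=
      pselect (exists p, weak_omega_limit x p /\ dual_VI_sol F K p).
    exists p; split => // z xz dz.
    have dist_cvg q : dual_VI_sol F K q ->
        exists l : R, `|x t - q| ^+ 2 @[t --> +oo] --> l.
      exact: (trajectory_dist_cvg K F L lambda).
    have [[l hl] [m hm]] := (dist_cvg z dz, dist_cvg p dp).
    exact: (opial_unique x z p l m).
  by exists p0; split => // z xz dz; case: nop; exists z.
have [delta delta0 sep] := C4 p dp.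
have omega_sub z : weak_omega_limit x z ->
    ([set p] `|` zeros_outside_dual F K) z.
  move=> xz; have [Kz Fz] := omega z xz.
  have [dz|ndz] := pselect (dual_VI_sol F K z); first by left; exact: omega_p.
  by right; split => //; case: Fz.
have [z xz xcvg] : exists2 z, weak_omega_limit x z &
    weak_cvg_to (x t @[t --> +oo]) z.
  apply: (separated_weak_omega_limit_cvg x M (2 * delta)) => //.
  - by rewrite mulr_gt0.
  - move=> v t t1.
    exact: is_derive_continuous _ _ _ (is_derive_inner _ _ _ v (dx t t1)).
  - by move=> z w xz xw; apply: sep; exact: omega_sub.
exists z; split => //.
  have [Kz [Fz|dz]] := omega z xz; last exact: (dual_VI_sol_sub K F L).
  by split => // w Kw; rewrite Fz linear0l.
have xy : weak_cvg_to (x t - residual K F lambda (x t) @[t --> +oo]) z.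
  exact: weak_cvg_sub_strong xcvg res0.
move=> v; suff : '[y t, v] @[t --> +oo] --> '[z, v] by [].
have xyv : '[x t - residual K F lambda (x t), v] @[t --> +oo] --> '[z, v] :=
  xy v.
apply: cvg_near_eq xyv; near=> t.
have t0 : 0 <= t by near: t; apply: nbhs_pinfty_ge; exact: num_real.
by rewrite yE// /residual opprB addrC subrK.
Unshelve. all: by end_near. Qed.
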